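(* Let $k\ge 2$ and let $w_n$ be the number of weak-ordering chains in $\mathcal{WOC}(n)$ subject to the stopping condition $x_{i_1}=\cdots=x_{i_k}$ (with distinct indices). Let $a_n$ be the number of chains in $\mathcal{WOC}(n)$ not containing this condition, i.e. the number of ordered set partitions of $[n]$ all of whose blocks have size at most $k-1$ (with $a_0=1$). Then $w_i=f_i$ for $1\le i<k$, where $f_i$ is the $i$-th Fubini number, and for $n\ge k$, \[ w_n=\sum_{i=1}^{k-1}\binom{n}{i}a_{n-i}+\sum_{j=k}^{n}\binom{j-1}{k-1}\sum_{i=0}^{j-k}\binom{j-k}{i}a_ia_{j-k-i}. \]
   Context: A weak-ordering chain on $x_1,\dots,x_m$ is an expression $x_{i_1}\,\mathrm{op}\,x_{i_2}\,\mathrm{op}\cdots\mathrm{op}\,x_{i_m}$, where $(i_1,\dots,i_m)$ is an ordering of $[m]$ and each $\mathrm{op}$ is $<$ or $=$; expressions defining the same ordered set partition of $[m]$ (blocks = index sets of equal variables) are identified. $\mathcal{WOC}(m)$ is the set of these chains; $|\mathcal{WOC}(m)|=f_m$, the Fubini (ordered Bell) numbers $1,1,3,13,75,\dots$ given by $f_0=1$, $f_m=\sum_{i=1}^m\binom{m}{i}f_{m-i}$. Each chain in $\mathcal{WOC}(m)$, $m\ge 2$, arises uniquely from its restriction to $x_1,\dots,x_{m-1}$ by inserting $x_m$; this gives a rooted tree with root $x_1$ whose level-$m$ nodes are the elements of $\mathcal{WOC}(m)$. The restricted generating tree of order $n$ for a stopping condition is the part of this tree up to level $n$ in which any node containing the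 stopping condition has no descendants; ''the number of weak-ordering chains in $\mathcal{WOC}(n)$ subject to the stopping condition'' is the number of leaves of this tree (nodes at level $n$ plus nodes containing the condition), equivalently the number of chains in $\mathcal{WOC}(n)$ avoiding the condition plus, for each $j\le n$, the number of chains in $\mathcal{WOC}(j)$ containing the condition whose restriction to $x_1,\dots,x_{j-1}$ avoids it. Here a chain contains the stopping condition if some $k$ distinct variables are all equal in it (some block of the partition has size $\ge k$). *)

(* Defs.v *)
From HB Require Import structures.
From mathcomp Require Import all_boot.

Set Implicit Arguments.
Unset Strict Implicit.
Unset Printing Implicit Defensive.

(* The variables x_1, ..., x_m are indexed by 'I_m, so x_i is the ordinal of
   value i - 1.  The list of blocks [:: B_1; ...; B_r] encodes the chain in which
   the variables within a block are equal and those of B_p are smaller than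
   those of B_q when p < q. *)
Definition is_osp (m : nat) (s : seq {set 'I_m}) : bool :=
  uniq s && partition [set B in s] [set: 'I_m].

Record woc (m : nat) := WOC { blocks :> seq {set 'I_m}; blocksP : is_osp blocks }.

HB.instance Definition _ (m : nat) := [isSub for @blocks m].
HB.instance Definition _ (m : nat) := [Countable of woc m by <:].

Lemma size_woc (m : nat) (c : woc m) : size c <= m.
Proof.
case/andP: (blocksP c) => Us part_s.
have := card_partition part_s; rewrite cardsT card_ord => eq_m; rewrite [leqRHS]eq_m.
have <- : #|[set B in blocks c]| = size c by rewrite cardsE; apply/card_uniqP.
rewrite -sum1_card; apply: leq_sum => B sB.
by rewrite card_gt0 (partition_neq0 part_s sB).
Qed.

Definition woc_bseq (m : nat) (c : woc m) : m.-bseq {set 'I_m} :=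
  Bseq (size_woc c).

Lemma woc_bseqK (m : nat) :
  pcancel (@woc_bseq m) (fun b => insub (b : seq {set 'I_m})).
Proof. by move=> c; rewrite /= valK. Qed.

HB.instance Definition _ (m : nat) : isFinite (woc m) :=
  PCanIsFinite (@woc_bseqK m).

Definition restrict_block (m : nat) (B : {set 'I_m.+1}) : {set 'I_m} :=
  widen_ord (leqnSn m) @^-1: B.

Lemma restrict_subproof (m : nat) (c : woc m.+1) :
  is_osp [seq B <- map (@restrict_block m) c | B != set0].
Proof.
case/andP: (blocksP c) => Us /and3P[/eqP covc /trivIsetP tic _].
have eq_block A B (x : 'I_m) : A \in blocks c -> B \in blocks c ->
    x \in restrict_block A -> x \in restrict_block B -> A = B.
  rewrite !inE => cA cB xA xB; apply/eqP/idPn => neqAB.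
  have := tic A B; rewrite !inE => /(_ cA cB neqAB).
  by move=> /pred0P/(_ (widen_ord (leqnSn m) x)) /=; rewrite xA xB.
apply/andP; split.
  rewrite filter_map map_inj_in_uniq ?filter_uniq // => A B.
  rewrite !mem_filter /= => /andP[/set0Pn[x xA] cA] /andP[_ cB] eqAB.
  by apply: (eq_block A B x); rewrite // -eqAB.
apply/and3P; split; last by rewrite inE mem_filter eqxx.
- apply/eqP/setP=> x; rewrite inE; apply/bigcupP.
  have: widen_ord (leqnSn m) x \in cover [set B in blocks c] by rewrite covc inE.
  case/bigcupP=> B; rewrite inE => cB xB; exists (restrict_block B).
    rewrite inE mem_filter map_f // andbT; apply/set0Pn; exists x.
    by rewrite inE.
  by rewrite inE.
apply/trivIsetP=> A B; rewrite !inE !mem_filter.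
case/andP=> _ /mapP[A1 cA ->] /andP[_ /mapP[B1 cB ->]] neqAB.
apply/pred0P=> x /=; apply/negP=> /andP[xA xB].
by case/eqP: neqAB; rewrite (eq_block A1 B1 x).
Qed.

(* Deletion of the last variable: the parent in the generating tree. *)
Definition restrict (m : nat) (c : woc m.+1) : woc m :=
  WOC (restrict_subproof c).

Definition stopping (k m : nat) (c : woc m) : bool :=
  [exists S : {set 'I_m},
    (#|S| == k) && has (fun B : {set 'I_m} => S \subset B) c].

(* Nodes of the generating tree none of whose proper ancestors satisfies the
   stopping condition; the root is at level 1, and level 0 is empty. *)
Fixpoint unstopped (k m : nat) : pred (woc m) :=
  match m return pred (woc m) with
  | 0 => pred0
  | m'.+1 => fun c =>
      (m' == 0) ||
      unstopped k (restrict c) && ~~ stopping k (restrict c)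
  end.

Definition rnode (k n m : nat) (c : woc m) : bool :=
  (m <= n) && unstopped k c.

Definition rleaf (k n m : nat) (c : woc m) : bool :=
  rnode k n c && ~~ [exists d : woc m.+1, (restrict d == c) && rnode k n d].

Definition w (k n : nat) : nat :=
  \sum_(1 <= m < n.+1) #|[set c : woc m | rleaf k n c]|.

Definition a (k n : nat) : nat := #|[set c : woc n | ~~ stopping k c]|.

(* [:: f_m; f_(m-1); ...; f_0] *)
Fixpoint fubini_rev (m : nat) : seq nat :=
  if m is m'.+1 then
    let s := fubini_rev m' in
    (\sum_(1 <= i < m.+1) 'C(m, i) * nth 0 s i.-1) :: s
  else [:: 1].

Definition fubini (m : nat) : nat := head 0 (fubini_rev m).

Lemma nth_fubini_rev (m i : nat) : i <= m -> nth 0 (fubini_rev m) i = fubini (m - i).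
Proof.
elim: m i => [|m IHm] [|i] //= lt_im.
by rewrite IHm // subSS.
Qed.

Lemma fubini0 : fubini 0 = 1. Proof. by []. Qed.

Lemma fubiniE (m : nat) : 0 < m ->
  fubini m = \sum_(1 <= i < m.+1) 'C(m, i) * fubini (m - i).
Proof.
case: m => // m _; rewrite {1}/fubini /=; apply: eq_big_nat => -[|i] // /= lt_im.
by rewrite nth_fubini_rev // subSS.
Qed.

Lemma stopping_block (k m : nat) (c : woc m) :
  stopping k c = has (fun B : {set 'I_m} => k <= #|B|) c.
Proof.
apply/existsP/hasP=> [[S /andP[/eqP <- /hasP[B cB sSB]]] | [B cB lekB]].
  by exists B => //; apply: subset_leq_card.
have [S] : {S : {set 'I_m} | S \subset B & #|S| = k}.
  have : 0 < #|[set S : {set 'I_m} | S \subset B & #|S| == k]|.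
    by rewrite cards_draws bin_gt0.
  rewrite card_gt0 => /set0Pn/sigW[S]; rewrite inE => /andP[sSB /eqP].
  by exists S.
by move=> sSB cardS; exists S; rewrite cardS eqxx /=; apply/hasP; exists B.
Qed.

Lemma a0 (k : nat) : 0 < k -> a k 0 = 1.
Proof.
move=> k_gt0; have osp0 : is_osp ([::] : seq {set 'I_0}).
  apply/andP; split=> //; apply/and3P; split; last by rewrite inE.
    by apply/eqP/setP => -[].
  by apply/trivIsetP=> A B; rewrite inE.
apply/eqP/cards1P; exists (WOC osp0); apply/setP => c; rewrite !inE.
have c0 : blocks c = [::] by apply/nilP; rewrite /nilp -leqn0 size_woc.
have -> : c = WOC osp0 by apply: val_inj.
by rewrite stopping_block eqxx.
Qed.

(* Main.v *)
Require Import Defs.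
From mathcomp Require Import all_boot.

(** An internal leaf of the restricted tree, at level [j], is a chain whose block
    containing the last variable has exactly [k] elements while all other blocks
    have fewer; the leaves at level [n] are these together with the avoiding
    chains.  Splitting off the first block gives a recursion for the number of
    avoiding chains and for the number [pointed k j] of internal leaves at level
    [j]; in the latter the first block either contains the last variable, and an
    avoiding chain follows, or it does not.  The closed form of the theorem
    satisfies the same recursion. *)

(** * Ordered set partitions of a finite set and their enumeration *)

Section OrderedSetPartitions.
Context {T : finType}.
Implicit Types (A B : {set T}) (s : seq {set T}) (Q : pred (seq {set T})).

(** The recursive form exposes the first block; an arbitrary ground set [A] keeps the remainder
    [A :\: B] in the same type. *)
Fixpoint osp A s : bool :=
  if s is B :: s' then [&& B != set0, B \subset A & osp (A :\: B) s']
  else A == set0.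

Lemma osp_sub A s B : osp A s -> B \in s -> B \subset A.
Proof.
elim: s A => //= C s IHs A /and3P[_ sCA osp_s].
rewrite inE => /predU1P[-> // | /(IHs _ osp_s)].
by move=> /subset_trans; apply; apply: subsetDl.
Qed.

Lemma osp_neq0 A s B : osp A s -> B \in s -> B != set0.
Proof.
elim: s A => //= C s IHs A /and3P[C0 _ osp_s].
by rewrite inE => /predU1P[-> | /(IHs _ osp_s)].
Qed.

Lemma ospE A s : (uniq s && partition [set B in s] A) = osp A s.
Proof.
elim: s A => [|B s IHs] A.
  have -> : [set B : {set T} in [::]] = set0 by apply/setP=> B; rewrite !inE.
  apply/idP/eqP=> [/and4P[_ /eqP <- _ _] | ->]; first by rewrite /cover big_set0.
  by rewrite partition_set0 eqxx.
have -> : [set C in B :: s] = B |: [set C in s] by apply/setP=> C; rewrite !inE.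
rewrite /=; apply/idP/and3P=> [/andP[/andP[sB Us] partA] | [B0 sBA]].
  have PB : B \in B |: [set C in s] by rewrite setU11.
  split; first exact: partition_neq0 partA PB.
    by rewrite -(cover_partition partA); apply: bigcup_sup PB.
  by rewrite -IHs Us; have := partitionD1 partA PB; rewrite setU1K ?inE.
(* If [B] occurred again it would lie in [A :\: B], hence be empty. *)
move=> osp_s; have sB : B \notin s.
  apply: contra B0 => /(osp_sub _ _ _ osp_s); rewrite subsetD => /andP[_].
  by rewrite -setI_eq0 setIid.
move: osp_s; rewrite -IHs sB => /andP[-> part_s] /=.
rewrite -{1}(setID A B) (setIidPr sBA); apply: partitionU1 => //.
by rewrite -setI_eq0 setIDA setDIl setDv set0I.
Qed.

(* [n] is fuel; the enumeration of the ordered set partitions of [A] is complete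
   when [#|A| <= n]. *)
Fixpoint osps (n : nat) A : seq (seq {set T}) :=
  if A == set0 then [:: [::]]
  else if n is n'.+1 then
    [seq B :: s | B <- enum [pred B : {set T} | B != set0 & B \subset A],
                  s <- osps n' (A :\: B)]
  else [::].

Lemma card_setD_lt A B n :
  B != set0 -> B \subset A -> #|A| <= n.+1 -> #|A :\: B| <= n.
Proof.
move=> B0 sBA leA; rewrite cardsD (setIidPr sBA) -ltnS.
by apply: leq_trans leA; rewrite ltn_subrL !card_gt0 B0 (subset_neq0 sBA).
Qed.

Lemma mem_osps n A s : #|A| <= n -> (s \in osps n A) = osp A s.
Proof.
elim: n A s => [|n IHn] A s leA /=.
  move: leA; rewrite leqn0 cards_eq0 => /eqP ->; rewrite eqxx.
  by case: s => [|B s] /=; rewrite ?eqxx // subset0 andbA andNb.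
have [-> | A0] := eqVneq A set0.
  by case: s => [|B s] /=; rewrite ?eqxx // subset0 andbA andNb.
apply/allpairsPdep/idP=> [[B [s' [+ + ->]]] | ].
  rewrite mem_enum inE => /= /andP[B0 sBA].
  by rewrite IHn ?card_setD_lt // B0 sBA.
case: s => [|B s] /=; first by rewrite (negPf A0).
case/and3P=> B0 sBA osp_s; exists B, s.
by rewrite mem_enum inE /= B0 sBA IHn ?card_setD_lt.
Qed.

Lemma osps_uniq n A : uniq (osps n A).
Proof.
elim: n A => [|n IHn] A /=; case: ifP => // _.
apply: allpairs_uniq_dep => [|B _|]; rewrite ?enum_uniq //.
by move=> [B s] [C t] _ _ /= [-> ->].
Qed.

Lemma count_osps0 n Q : count Q (osps n set0) = Q [::].
Proof. by case: n => [|n] /=; rewrite eqxx /= addn0. Qed.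

Lemma count_ospsS n A Q : A != set0 ->
  count Q (osps n.+1 A) =
  \sum_(B : {set T} | (B != set0) && (B \subset A))
     count (fun s => Q (B :: s)) (osps n (A :\: B)).
Proof.
move=> A0; rewrite /= (negPf A0) count_flatten -map_comp sumnE big_map big_enum.
by apply: eq_bigr => B _; rewrite /= count_map.
Qed.

Lemma sum_subset_card A m n (F : nat -> nat) :
  \sum_(B : {set T} | (B \subset A) && (m <= #|B| < n)) F #|B|
  = \sum_(m <= i < n) 'C(#|A|, i) * F i.
Proof.
(* The size bound becomes a sum over [i] with [i == #|B|], so the two sums can be exchanged. *)
rewrite big_mkcondr; under eq_bigr => B _ do rewrite -(big_nat1_eq addn F).
rewrite (exchange_big_dep xpredT) //=.
apply: eq_bigr => i _.
rewrite (eq_bigl [in [set B : {set T} | B \subset A & #|B| == i]]) => [|B].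
  by rewrite sum_nat_const cards_draws.
by rewrite !inE (eq_sym i).
Qed.

End OrderedSetPartitions.

(** * Counting avoiding chains *)

Lemma card_woc n N (P : pred (seq {set 'I_n})) : n <= N ->
  #|[set c : woc n | P c]| = count P (osps N [set: 'I_n]).
Proof.
move=> leN; rewrite cardE -(size_map (@blocks n)) -size_filter.
apply/perm_size/uniq_perm.
- by rewrite map_inj_uniq ?enum_uniq //; apply: val_inj.
- by rewrite filter_uniq ?osps_uniq.
move=> s; rewrite mem_filter mem_osps ?cardsT ?card_ord // -ospE.
apply/mapP/andP=> [[c + ->] | [Ps osp_s]].
  by rewrite mem_enum inE => ->; split=> //; apply: blocksP.
by exists (WOC osp_s); rewrite ?mem_enum ?inE.
Qed.

Definition small (k : nat) {T : finType} (s : seq {set T}) : bool :=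
  all (fun B : {set T} => #|B| < k) s.

(** The induction hypothesis is a premise so that [count_small] can use this step twice: for [A] and
    for the standard ground set of the same cardinality. *)
Lemma count_small_step k N {T : finType} (A : {set T}) :
    (forall B : {set T}, #|B| <= N -> count (small k) (osps N B) = a k #|B|) ->
    #|A| <= N.+1 -> A != set0 ->
  count (small k) (osps N.+1 A)
  = \sum_(1 <= i < k) 'C(#|A|, i) * a k (#|A| - i).
Proof.
move=> IHN leA A0; rewrite count_ospsS // -sum_subset_card.
rewrite [LHS](bigID (fun B : {set T} => #|B| < k)) /= [X in _ + X]big1 ?addn0.
  apply: eq_big => [B|B /andP[/andP[B0 sBA] ltB]].
    by rewrite card_gt0 andbA (andbC (B \subset A)).
  have <- : #|A :\: B| = #|A| - #|B| by rewrite cardsD (setIidPr sBA).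
  rewrite -IHN ?card_setD_lt //.
  by apply: eq_count => s /=; rewrite ltB.
by move=> B /andP[_ /negPf geB]; apply/eqP; rewrite -leqn0 leqNgt -has_count;
  apply/hasP=> -[s _] /=; rewrite geB.
Qed.

Lemma a_count k n N : n <= N -> a k n = count (small k) (osps N [set: 'I_n]).
Proof.
move=> leN; rewrite -card_woc //; apply: eq_card => c; rewrite !inE.
rewrite stopping_block -all_predC; apply: eq_all => B /=.
by rewrite -ltnNge.
Qed.

(** The counts for [A] and for ['I_#|A|] obey the same recursion in the cardinality, so no bijection
    has to be transported. *)
Lemma count_small k N {T : finType} (A : {set T}) :
  #|A| <= N -> count (small k) (osps N A) = a k #|A|.
Proof.
elim: N T A => [|N IHN] T A leA; (have [-> | A0] := eqVneq A set0;
    first by rewrite cards0 count_osps0 (a_count k 0 0) //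
      (_ : [set: 'I_0] = set0) ?count_osps0 //; apply/setP=> -[]).
  by move: leA; rewrite leqn0 cards_eq0 (negPf A0).
rewrite count_small_step // => [|B]; last exact: IHN.
rewrite (a_count k _ _ leA) count_small_step ?cardsT ?card_ord //.
  by move=> B; apply: IHN.
by rewrite -card_gt0 cardsT card_ord card_gt0.
Qed.

Lemma a_rec k n : 0 < n -> a k n = \sum_(1 <= i < k) 'C(n, i) * a k (n - i).
Proof.
case: n => // n _; rewrite (a_count k n.+1 n.+1) // count_small_step.
- by rewrite cardsT card_ord.
- by move=> B; apply: count_small.
- by rewrite cardsT card_ord.
by rewrite -card_gt0 cardsT card_ord.
Qed.

(** * Counting internal leaves *)

Lemma count_andl {T : Type} (b : bool) (Q : pred T) l :
  count (fun s => b && Q s) l = b * count Q l.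
Proof. by case: b; rewrite ?mul1n //= mul0n; elim: l. Qed.

(** The binomial chooses the other [k - 1] members of the block of the last variable; then [i] of
    the remaining variables come before this block and the rest after it. *)
Definition pointed k n :=
  'C(n.-1, k.-1) *
  \sum_(0 <= i < (n - k).+1) 'C(n - k, i) * a k i * a k (n - k - i).

Lemma pointed_small k n : 1 < k -> n < k -> pointed k n = 0.
Proof. by case: k n => [|[|k]] [|n] // _ lt_nk; rewrite /pointed bin_small. Qed.

(** Both sides count disjoint pairs of a [p]-set and a [q]-set in an [n]-set. *)
Lemma mul_bin_swap n p q : 'C(n, p) * 'C(n - p, q) = 'C(n, q) * 'C(n - q, p).
Proof.
have small_prod u v : n < u + v -> 'C(n, u) * 'C(n - u, v) = 0.
  case: (leqP u n) => [le_un | ?] lt_n; last by rewrite bin_small.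
  by rewrite [X in _ * X]bin_small ?muln0 // ltn_subLR.
have [le_pq | gt_pq] := leqP (p + q) n; last first.
  by rewrite !small_prod // addnC.
have fact_prod u v : u + v <= n ->
    'C(n, u) * 'C(n - u, v) * (u`! * v`! * (n - (u + v))`!) = n`!.
  move=> le_uv; have le_un := leq_trans (leq_addr v u) le_uv.
  rewrite -(bin_fact le_un) subnDA -(@bin_fact (n - u) v) ?leq_subRL //.
  by rewrite -!mulnA; congr (_ * _); rewrite !mulnA; congr (_ * _ * _);
    rewrite mulnC.
apply/eqP; rewrite -(@eqn_pmul2r (p`! * q`! * (n - (p + q))`!)) ?muln_gt0 ?fact_gt0 //.
by rewrite fact_prod // (mulnC p`!) addnC fact_prod // addnC.
Qed.

Lemma mul_bin_nested n i l : l <= i <= n ->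
  'C(n, i) * 'C(i, l) = 'C(n, l) * 'C(n - l, i - l).
Proof.
(* Choosing the complement of the [i]-set instead makes the two chosen sets disjoint, so
   [mul_bin_swap] applies. *)
case/andP=> le_li le_in; rewrite -[in LHS](bin_sub le_in) -{2}(subKn le_in).
rewrite mul_bin_swap; congr (_ * _).
rewrite -[RHS]bin_sub ?leq_sub2r //; congr 'C(_, _).
by rewrite subnBA // subnK // (leq_trans le_li).
Qed.

(** The term [i = 0] of the closed form means that no block precedes that of the last variable. In
    the other terms [a_rec] splits off the first block of the preceding part, of size [l], and the
    sums are exchanged. *)
Lemma pointed_rec k n : 1 < k -> 0 < n ->
  pointed k n = 'C(n.-1, k.-1) * a k (n - k)
                + \sum_(1 <= i < k) 'C(n.-1, i) * pointed k (n - i).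
Proof.
move=> k_gt1 n_gt0; have k_gt0 := ltnW k_gt1.
have [lt_nk | le_kn] := ltnP n k.
  rewrite pointed_small // bin_small ?ltn_predRL ?prednK // mul0n big1 // => i _.
  by rewrite pointed_small ?muln0 // (leq_ltn_trans (leq_subr _ _)).
rewrite {1}/pointed; set N := n - k.
rewrite big_ltn // bin0 a0 // subn0 !mul1n mulnDr; congr (_ + _).
under eq_big_nat => i /andP[i_gt0 _].
  rewrite (a_rec k i) // big_distrr big_distrl /=; over.
rewrite exchange_big_nat big_distrr /=; apply: eq_big_nat => l /andP[l_gt0 _].
(* For [l > N] fewer than [k] variables remain for the block of the last variable, and both sides
   vanish. *)
have [le_lN | lt_Nl] := leqP l N; last first.
  rewrite pointed_small ?muln0 //; last first.
    by rewrite ltn_psubLR // addnC -ltn_psubLR // (leq_trans _ lt_Nl).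
  rewrite big_nat big1 ?muln0 // => i /andP[_ lt_iN].
  by rewrite (@bin_small i l) ?muln0 // (leq_ltn_trans _ lt_Nl).
(* The terms with [i < l] vanish; the others are reindexed by [i - l]. *)
rewrite (@big_cat_nat _ _ _ l) //= ?(leq_trans le_lN) //.
rewrite [X in X + _]big_nat big1 ?add0n; last first.
  by move=> i /andP[_ lt_il]; rewrite (@bin_small i l) ?muln0.
rewrite -{1}[l]add0n big_addn subSn // /pointed.
have -> : n - l - k = N - l by rewrite subnAC.
have -> : (n - l).-1 = n.-1 - l by rewrite -!subn1 subnAC.
rewrite mulnA (mul_bin_swap n.-1 l).
have -> : n.-1 - k.-1 = N by rewrite -subSS !prednK.
rewrite -mulnA; congr (_ * _); rewrite big_distrr; apply: eq_big_nat => i /= lt_i.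
rewrite addnK mulnA mulnA mul_bin_nested; last first.
  by rewrite leq_addl addnC -leq_subRL // -ltnS.
by rewrite addnK -!mulnA addnC subnDA.
Qed.

(** In an ordered set partition of a set containing [x], exactly one block takes the first
    branch. *)
Definition marked (k : nat) {T : finType} (x : T) (s : seq {set T}) : bool :=
  all (fun B : {set T} => if x \in B then #|B| == k else #|B| < k) s.

(** Pascal's rule: the [k]-subsets of [A] that miss [x] are those of [A :\ x], and cancelling them
    leaves the ones through [x]. *)
Lemma card_subsets_with {T : finType} (A : {set T}) x k : 0 < k -> x \in A ->
  #|[set B : {set T} | [&& x \in B, B \subset A & #|B| == k]]| = 'C(#|A|.-1, k.-1).
Proof.
case: k => // k _ xA; have := cards_draws A k.+1.
rewrite (cardsD1 x A) xA binS -(cards_draws (A :\ x) k.+1) /=.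
rewrite -(cardsID [set B : {set T} | x \in B]) addnC => /eqP.
have -> : [set B : {set T} | B \subset A & #|B| == k.+1]
            :\: [set B : {set T} | x \in B]
          = [set B : {set T} | B \subset A :\ x & #|B| == k.+1].
  by apply/setP=> B; rewrite !inE subsetD1 andbA (andbC (_ \notin _)).
rewrite eqn_add2l => /eqP <-; apply: eq_card => B.
by rewrite !inE andbC.
Qed.

Lemma count_marked k N {T : finType} (A : {set T}) x :
    1 < k -> x \in A -> #|A| <= N ->
  count (marked k x) (osps N A) = pointed k #|A|.
Proof.
move=> k_gt1; elim: N A => [|N IHN] A xA leA.
  by move: leA; rewrite leqn0 cards_eq0 => /eqP A0; rewrite A0 inE in xA.
have A0 : A != set0 by apply/set0Pn; exists x.
rewrite count_ospsS // (bigID (fun B : {set T} => x \in B)) /=.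
rewrite pointed_rec ?card_gt0 //; congr (_ + _).
  rewrite -(card_subsets_with A x) ?(ltnW k_gt1) // -sum1_card big_distrl /=.
  rewrite big_mkcond [RHS]big_mkcond; apply: eq_bigr => B _; rewrite inE.
  case xB: (x \in B); rewrite ?andbF ?andFb //= andbT.
  have -> /= : B != set0 by apply/set0Pn; exists x.
  case sBA: (B \subset A) => //=; rewrite count_andl.
  case: eqP => //= cardB; rewrite !mul1n.
  have <- : #|A :\: B| = #|A| - k by rewrite cardsD (setIidPr sBA) cardB.
  have leAB : #|A :\: B| <= N.
    by apply: card_setD_lt leA => //; apply/set0Pn; exists x.
  (* Once the first block contains [x], no later block does, so [marked] reduces to [small]. *)
  rewrite -(count_small k N) //; apply: eq_in_count => s.
  rewrite mem_osps // => osp_s; apply: eq_in_all => C sC.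
  case: ifP => // xC; move/subsetP/(_ x xC): (osp_sub _ _ _ osp_s sC).
  by rewrite inE xB.
(* A first block without [x] is a nonempty subset of [A :\ x] of size below [k]. *)
have -> : #|A|.-1 = #|A :\ x| by rewrite (cardsD1 x A) xA.
rewrite -sum_subset_card big_mkcond [RHS]big_mkcond; apply: eq_bigr => B _.
rewrite subsetD1 card_gt0 -andbA; case B0: (B != set0); rewrite ?andbF //=.
case sBA: (B \subset A) => //=; case xB: (x \in B) => //=.
rewrite count_andl; case: ifP => ltB; rewrite ?mul0n // mul1n.
rewrite IHN ?inE ?xB ?xA ?card_setD_lt //.
by rewrite cardsD (setIidPr sBA).
Qed.

(** * Deletion of the last variable and the leaves of the tree *)

Lemma widen_inj m : injective (widen_ord (leqnSn m)).
Proof. by move=> i j /(congr1 val) /= /val_inj. Qed.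

Lemma card_restrict_block {m} (B : {set 'I_m.+1}) :
  #|B| = (ord_max \in B) + #|restrict_block B|.
Proof.
rewrite (cardsD1 ord_max); congr (_ + _).
rewrite -(card_imset _ (widen_inj m)); apply: eq_card => x.
rewrite !inE; apply/andP/imsetP=> [[x_max xB] | [y + ->]].
  have lt_x : x < m by rewrite ltn_neqAle -ltnS ltn_ord andbT.
  by exists (Ordinal lt_x); [rewrite inE|]; rewrite (_ : widen_ord _ _ = x) //;
    apply: val_inj.
by rewrite inE -(inj_eq val_inj) /= ltn_eqF.
Qed.

Lemma osp_imset {T T' : finType} (f : T -> T') (A : {set T}) s :
  injective f -> osp A s -> osp (f @: A) [seq f @: (B : {set T}) | B <- s].
Proof.
move=> f_inj; elim: s A => [|B s IHs] A /=; first by rewrite imset_eq0.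
case/and3P=> B0 sBA osp_s; rewrite imset_eq0 B0 imsetS //=.
suff -> : f @: A :\: f @: B = f @: (A :\: B) by apply: IHs.
apply/setP=> y; rewrite inE; apply/andP/imsetP=> [[fB /imsetP[x xA def_y]] | [x]].
  by exists x; rewrite // inE xA andbT; apply: contra fB => xB; rewrite def_y imset_f.
by rewrite inE => /andP[xB xA] ->; rewrite mem_imset // xB imset_f.
Qed.

Lemma restrict_surj {m} (c : woc m) : exists d : woc m.+1, restrict d = c.
Proof.
(* The child puts the new variable alone in a first block. *)
pose s := [set ord_max] ::
  [seq widen_ord (leqnSn m) @: (B : {set 'I_m}) | B <- blocks c].
have osp_c : osp [set: 'I_m] c by rewrite -ospE; apply: blocksP.
have osp_s : is_osp s.
  rewrite /is_osp ospE /= -card_gt0 cards1 subsetT /=.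
  suff -> : [set: 'I_m.+1] :\ ord_max = widen_ord (leqnSn m) @: [set: 'I_m].
    by apply: osp_imset => //; apply: widen_inj.
  apply/setP=> x; rewrite !inE andbT; apply/idP/imsetP=> [x_max | [y _ ->]].
    have lt_x : x < m by rewrite ltn_neqAle -ltnS ltn_ord andbT.
    by exists (Ordinal lt_x) => //; apply: val_inj.
  by rewrite -(inj_eq val_inj) /= ltn_eqF.
exists (WOC osp_s); apply: val_inj => /=.
have -> : restrict_block [set @ord_max m] = set0.
  by apply/setP=> x; rewrite !inE -(inj_eq val_inj) /= ltn_eqF.
rewrite eqxx /= -map_comp map_id_in => [|B _] /=; last first.
  by apply/setP=> x; rewrite inE mem_imset //; apply: widen_inj.
by apply/all_filterP/allP=> B; apply: osp_neq0 osp_c.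
Qed.

(** Deletion shrinks only the block of the last variable, by one; a block emptied by it is too small
    to matter since [k > 0]. *)
Lemma stopping_restrict k {m} (c : woc m.+1) : 0 < k ->
  stopping k (restrict c)
  = has (fun B : {set 'I_m.+1} => k + (ord_max \in B) <= #|B|) c.
Proof.
move=> k_gt0; rewrite stopping_block has_filter -filter_predI -has_filter has_map.
apply: eq_has => B /=; rewrite card_restrict_block addnC leq_add2l.
case: leqP => //= le_k; rewrite -card_gt0.
exact: leq_trans le_k.
Qed.

Lemma restrict_stopping k {m} (c : woc m.+1) : 0 < k ->
  stopping k (restrict c) -> stopping k c.
Proof.
move=> k_gt0; rewrite stopping_restrict // stopping_block.
by apply: sub_has => B /=; apply: leq_trans; apply: leq_addr.
Qed.

Lemma stopping_marked k {m} (c : woc m.+1) : 0 < k ->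
  stopping k c && ~~ stopping k (restrict c) = marked k ord_max c.
Proof.
move=> k_gt0; rewrite stopping_restrict // stopping_block -all_predC /marked.
have /andP[_ part_c] := blocksP c.
apply/andP/allP=> [[/hasP[B cB le_kB] /allP small_c] C cC | c_marked].
  have := small_c C cC; have := small_c B cB; rewrite /= -!ltnNge.
  case xC: (_ \in C); case xB: (_ \in B) => ltB ltC;
    rewrite ?addn0 ?addn1 // in ltB ltC *.
    (* The large block [B] contains the last variable, so by disjointness it is the block [C]. *)
    rewrite (_ : C = B); first by rewrite eqn_leq le_kB andbT.
    have /trivIsetP tic := partition_trivIset part_c.
    apply/eqP/idPn => neqCB; have := tic C B; rewrite !inE => /(_ cC cB neqCB).
    by move/pred0P/(_ ord_max); rewrite /= xC xB.
  by rewrite ltnNge le_kB in ltB.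
split; last first.
  apply/allP=> B /c_marked /=; rewrite -ltnNge.
  by case: ifP => _; rewrite ?addn0 // => /eqP ->; rewrite addn1.
have : ord_max \in cover [set B in blocks c] by rewrite (cover_partition part_c) inE.
case/bigcupP=> B; rewrite inE => cB xB; apply/hasP; exists B => //.
by have := c_marked B cB; rewrite xB => /eqP ->.
Qed.

(** The condition passes from a chain to its descendants, so checking the parent covers all proper
    ancestors. *)
Lemma unstoppedE k {m} (c : woc m.+1) : 0 < k ->
  unstopped k c = ~~ stopping k (restrict c).
Proof.
move=> k_gt0; elim: m c => [|m IHm] c.
  by rewrite stopping_block (_ : blocks _ = [::]) //; apply/nilP;
    rewrite /nilp -leqn0 size_woc.
rewrite /= -/(unstopped k (restrict c)) IHm andbC.
case: (boolP (stopping k (restrict c))) => //= nstop.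
by apply: contra nstop; apply: restrict_stopping.
Qed.

(** Above the last level, an unstopped node avoiding the condition has a child by [restrict_surj],
    hence is no leaf. *)
Lemma rleafE k n m (c : woc m.+1) : m < n ->
  rleaf k n c = unstopped k c && (stopping k c || (m.+1 == n)).
Proof.
move=> lt_mn; rewrite /rleaf /rnode lt_mn; case c_un: (unstopped k c) => //.
rewrite !andTb -[RHS]negbK negb_or; congr (~~ _).
apply/existsP/andP=> [[d] | [c_st lt_m1n]].
  by case/and3P=> /eqP <- lt_m1n /andP[_ ->]; rewrite neq_ltn lt_m1n.
have [d def_c] := restrict_surj c; exists d.
have -> : unstopped k d by rewrite -def_c in c_un c_st; apply/orP; right; apply/andP.
by rewrite def_c eqxx andbT ltn_neqAle lt_m1n.
Qed.

(** Leaves containing the condition are the marked chains; the others occur only at level [n] and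
    are the avoiding chains there. *)
Lemma card_rleaf k n m : 1 < k -> m < n ->
  #|[set c : woc m.+1 | rleaf k n c]|
  = pointed k m.+1 + (m.+1 == n) * a k m.+1.
Proof.
move=> k_gt1 lt_mn; have k_gt0 := ltnW k_gt1.
rewrite -(cardsID [set c : woc m.+1 | stopping k c]); congr (_ + _).
  rewrite -[in RHS](card_ord m.+1) -cardsT -(count_marked k m.+1 _ ord_max) ?inE //.
    rewrite -card_woc //; apply: eq_card => c; rewrite !inE rleafE // unstoppedE //.
    by rewrite -stopping_marked //; case: (stopping k c); rewrite ?andbT ?andbF.
  by rewrite cardsT card_ord.
case: eqP => [def_n | ne_mn]; last first.
  apply: eq_card0 => c; rewrite !inE rleafE //; case: eqP => // _.
  by case: (stopping k c); rewrite ?andbF.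
rewrite mul1n; apply: eq_card => c; rewrite !inE rleafE // unstoppedE // -def_n eqxx.
rewrite orbT andbT; case c_st: (stopping k c) => //=.
by apply/negP=> /restrict_stopping; rewrite c_st => /(_ k_gt0).
Qed.

(** * Summation over the levels *)

Lemma w_pointed k n : 1 < k -> 0 < n ->
  w k n = a k n + \sum_(1 <= j < n.+1) pointed k j.
Proof.
move=> k_gt1; case: n => // n _; rewrite /w.
rewrite (eq_big_nat _ _ (F2 := fun m => pointed k m + (m == n.+1) * a k m)).
  rewrite big_split addnC; congr (_ + _).
  rewrite big_nat_recr //= eqxx mul1n big_nat big1 // => i /andP[_ lt_in].
  by rewrite ltn_eqF.
by case=> // m /andP[_ lt_m]; apply: card_rleaf.
Qed.

Lemma a_fubini k n : 0 < k -> n < k -> a k n = fubini n.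
Proof.
move=> k_gt0; elim/ltn_ind: n => -[|n] IHn lt_nk; first exact: a0.
(* The recursion of [a] runs up to [k - 1] and that of [fubini] only up to [n.+1]; the extra
   binomials are zero. *)
rewrite a_rec // fubiniE // (@big_cat_nat _ _ _ n.+2) //=.
rewrite [X in _ + X]big_nat [X in _ + X]big1 ?addn0 => [|i /andP[lt_ni _]]; last first.
  by rewrite bin_small.
apply: eq_big_nat => i /andP[i_gt0 _]; have lt_i : n.+1 - i < n.+1.
  by rewrite ltn_subrL i_gt0.
by rewrite IHn // (ltn_trans lt_i).
Qed.

Theorem theorem11 (k : nat) (hk : 2 <= k) :
  (forall i : nat, 1 <= i < k -> w k i = fubini i) /\
  (forall n : nat, k <= n ->
     w k n =
       \sum_(1 <= i < k) 'C(n, i) * a k (n - i)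
       + \sum_(k <= j < n.+1)
           'C(j.-1, k.-1) *
           \sum_(0 <= i < (j - k).+1) 'C(j - k, i) * a k i * a k (j - k - i)).
Proof.
have k_gt0 := ltnW hk.
have sum0 m : m <= k -> \sum_(1 <= j < m) pointed k j = 0.
  move=> le_mk; rewrite big_nat big1 // => j /andP[_ lt_jm].
  by rewrite pointed_small // (leq_trans lt_jm).
split=> [i /andP[i_gt0 lt_ik] | n le_kn].
  by rewrite w_pointed // sum0 // addn0 a_fubini.
have n_gt0 := leq_trans k_gt0 le_kn.
rewrite w_pointed // -a_rec // (@big_cat_nat _ _ _ k) //=; last exact: leqW.
by rewrite sum0.
Qed.
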